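(* Let $\mathbb E$ be a Euclidean space, $\mathcal V\subset\mathbb E$ a manifold of class $C^3$ with $\mathcal V\neq\mathbb E$, and $E$ a proper affine subspace of $\mathbb E$. Let $\zeta\in E\cap\mathcal V$ be such that $\Pi_{\mathcal V}$ is $C^2$ around $\zeta$ and $\mathcal V$ and $E$ intersect transversally at $\zeta$. Let $\varphi(x)=\Pi_{E\cap T_{\Pi_{\mathcal V}(x)}\mathcal V}(x)$ and $\mathcal W=E\cap\mathcal V\cap U$ for a small enough open neighborhood $U$ of $\zeta$ (see the context). Let $\nu,\gamma,\gamma'>0$ be such that for all $x_0\in B_\nu(\zeta)$ the sequence $x_{i+1}=\varphi(x_i)$ is well defined and converges to a point $x_\infty\in\mathcal W$, with $\|x_{i+1}-x_\infty\|\le\gamma\|x_i-x_\infty\|^2$ for all $i\ge0$ and $\|\Pi_{\mathcal W}(x_0)-x_\infty\|\le\gamma'\|\Pi_{\mathcal W}(x_0)-x_0\|^2$ (such $\nu,\gamma,\gamma'$ exist). Let $\Phi:B_\nu(\zeta)\to\mathbb E$ denote the limit operator $\Phi(x_0)=x_\infty$. Then $\Phi$ is differentiable at $\zeta$ and $D\Phi(\zeta)=\Pi_{T_\zeta\mathcal W^0}$.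
   Context: Manifolds are embedded submanifolds of $\mathbb E$. For an affine space $F$, $F^0$ denotes its underlying vector space. For $x$ in a manifold $\mathcal V$, $T_x\mathcal V=x+T_x\mathcal V^0$ is the affine tangent space at $x$, with underlying vector space $T_x\mathcal V^0$. $B_\nu(\zeta)$ is the open ball of center $\zeta$ and radius $\nu$. For a set $S\subset\mathbb E$, $\Pi_S(x)$ denotes the (unique) point of $S$ nearest to $x$, when it is well defined; for a linear or affine subspace it is the orthogonal projection. $E$ and $\mathcal V$ intersect transversally at $\zeta\in E\cap\mathcal V$ if $\mathrm{codim}(E^0\cap T_\zeta\mathcal V^0)=\mathrm{codim}(E^0)+\mathrm{codim}(T_\zeta\mathcal V^0)$. The open neighborhood $U$ of $\zeta$ is taken small enough that $\Pi_{\mathcal V}$ is well defined and of class $C^2$ on $U$, that $E\cap T_{\Pi_{\mathcal V}(x)}\mathcal V\neq\emptyset$ for $x\in U$ (so that $\varphi$ is well defined on $U$), and that $\mathcal W=E\cap\mathcal V\cap U$ is a manifold of class $C^3$ whose nearest-point projection $\Pi_{\mathcal W}$ is well defined and of class $C^2$ in a neighborhood of $\zeta$; such a neighborhood exists by transversality. *)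

(* Defs.v *)
From HB Require Import structures.
From mathcomp Require Import all_boot all_order all_algebra.
From mathcomp Require Import all_classical all_reals all_analysis.

Set Implicit Arguments.
Unset Strict Implicit.
Unset Printing Implicit Defensive.

Import Order.TTheory GRing.Theory Num.Theory.
Import numFieldNormedType.Exports.

Local Open Scope classical_set_scope.
Local Open Scope ring_scope.

(* Euclidean spaces: finite-dimensional real vector spaces whose norm comes
   from an inner product.  Positive definiteness of [dot] and the
   Cauchy-Schwarz inequality follow from [dot_normE] and the norm axioms. *)
HB.mixin Record NormedVector_isEuclidean (R : realType) E
    of NormedModule R E & Vector R E := {
  dot : E -> E -> R;
  dotC : forall u v, dot u v = dot v u;
  dot_linear : forall (a : R) (u v w : E),
    dot (a *: u + v) w = a * dot u w + dot v w;
  dot_normE : forall u, dot u u = `|u| ^+ 2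
}.

#[short(type="euclideanType")]
HB.structure Definition Euclidean (R : realType) :=
  {E of NormedModule R E & Vector R E & NormedVector_isEuclidean R E}.

(* [Ck k A f]: [f] is of class C^k on [A], where [A] is meant to be open.  The
   recursion goes through the maps x |-> Df(x)v for each fixed v; when [X] is
   finite-dimensional this amounts to x |-> Df(x) being of class C^(k-1). *)
Fixpoint Ck (R : realType) (X Y : normedModType R) (k : nat) (A : set X)
    (f : X -> Y) : Prop :=
  match k with
  | 0 => forall x, A x -> {for x, continuous f}
  | k'.+1 => (forall x, A x -> differentiable f x) /\
             (forall v : X, Ck k' A (fun x => 'd f x v))
  end.

Section Euclidean_geometry.
Context {R : realType} {E : euclideanType R}.
Implicit Types (S V F O : set E) (x y z v : E) (U L T : {vspace E}).

Definition nearest S x y : Prop :=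
  S y /\ forall z, S z -> `|x - y| <= `|x - z|.

Definition proj_defined S x : Prop := exists! y, nearest S x y.

(* Meaningful only where [proj_defined S x] holds. *)
Definition nearest_proj S x : E := xget 0 [set y | nearest S x y].

Definition Ck_proj_on (k : nat) S O : Prop :=
  (forall x, O x -> proj_defined S x) /\ Ck k O (nearest_proj S).

Definition Ck_proj_around (k : nat) S x : Prop :=
  exists O, [/\ open O, O x & Ck_proj_on k S O].

Definition affine_of x L : set E := [set y | y - x \in L].

Definition is_affine F L : Prop := exists x, F = affine_of x L.

Definition codim L : nat := (\dim {:E} - \dim L)%N.

(* Around [x], the C^k diffeomorphism [psi] from [O] onto [O'] (with inverse
   [g]) flattens [V] to the linear subspace [L]. *)
Definition flattens (k : nat) V L O (O' : set E) (psi g : E -> E) : Prop :=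
  [/\ open O /\ open O', Ck k O psi /\ Ck k O' g,
      (forall y, O y -> O' (psi y) /\ g (psi y) = y),
      (forall z, O' z -> O (g z) /\ psi (g z) = z) &
      (forall y, O y -> (V y <-> psi y \in L))].

Definition submanifold (k : nat) V : Prop :=
  exists d : nat, forall x, V x ->
    exists L O O' psi g, [/\ \dim L = d, O x & flattens k V L O O' psi g].

Definition velocity V x v : Prop :=
  exists (e : R) (c : R -> E),
    [/\ 0 < e, Ck 1 (ball (0 : R) e) c, (forall t, ball (0 : R) e t -> V (c t)),
        c 0 = x & derive1 c 0 = v].

(* The direction $T_x V^0$ of the tangent space at [x]: the linear subspace
   whose vectors are the velocities at [x] of the C^1 curves in [V].  If [V] is
   a submanifold of class C^1 or more and [V x], such a subspace exists, so that
   the default value is not used. *)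
Definition tangent0 V x : {vspace E} :=
  xget 0%VS [set T : {vspace E} | forall v, v \in T <-> velocity V x v].

Definition tangent V x : set E := affine_of x (tangent0 V x).

(* [L] is the direction of the affine subspace. *)
Definition transversal_at L V x : Prop :=
  codim (L :&: tangent0 V x)%VS = (codim L + codim (tangent0 V x))%N.

Definition phi_defined F V x : Prop :=
  proj_defined V x /\ F `&` tangent V (nearest_proj V x) !=set0.

Definition phi F V x : E := nearest_proj (F `&` tangent V (nearest_proj V x)) x.

End Euclidean_geometry.

(* Main.v *)
Require Import Defs.
From HB Require Import structures.
From mathcomp Require Import all_boot all_order all_algebra.
From mathcomp Require Import all_classical all_reals all_analysis.
From mathcomp Require Import ring lra.

Import Order.TTheory GRing.Theory Num.Theory.
Import numFieldNormedType.Exports.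

Local Open Scope classical_set_scope.
Local Open Scope ring_scope.

(** The set of velocities of [W] at [z] is exactly the range of
    [P = D(Pi_W)(z)]: a C^1 curve in [W] is fixed by [Pi_W], so its velocity is
    fixed by [P], and [t |-> Pi_W (z + t v)] is a C^1 curve in [W] with velocity
    [P v].  Comparing the points [Pi_W (z + t v)] and [Pi_W (z + t w)] of [W] as
    approximations of [z + t v] and letting [t -> 0] gives
    [|v - P v| <= |v - P w|], so that [P] is the orthogonal projection on its
    range.  Finally, since [z] is in [W],
    [|Phi x - Pi_W x| <= gamma' |Pi_W x - x|^2 <= gamma' |x - z|^2], and so
    [Phi] is tangent to [Pi_W] at [z]. *)

Section Differentiability.
Context {R : realType} {X Y : normedModType R}.

Lemma is_diff_line (x v : X) (t : R) :
  is_diff t (fun s : R => x + s *: v) ( *:%R ^~ v).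
Proof.
have := is_diffD (is_diff_cst x t) (is_diff_scalel t v).
by rewrite add0r.
Qed.

(** A quadratic error is negligible at first order, so the first-order expansion of [f] at [x] is
    also one for [g], and a continuous linear map in such an expansion is unique. *)
Lemma is_diff_near_quadratic (f g : X -> Y) (x : X) (C : R) :
  differentiable f x -> g x = f x ->
  (\forall y \near x, `|g y - f y| <= C * `|y - x| ^+ 2) ->
  is_diff x g ('d f x).
Proof.
move=> df gfx gf.
(* [C] has no assumed sign, so [|C| + 1] serves as a positive upper bound by which to divide. *)
have C0 : 0 < `|C| + 1 by rewrite ltr_wpDl.
have gE : g \o shift x = cst (g x) + 'd f x +o_ 0 id.
  apply: (eqaddo_trans (g := f \o shift x)); last first.
    by rewrite gfx; exact: diff_locally.
  apply: eqaddoE; apply/eqaddoP => _/posnumP[e].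
  have e0 : 0 < e%:num / (`|C| + 1) by rewrite divr_gt0.
  near=> h.
  have : `|g (h + x) - f (h + x)| <= C * `|h| ^+ 2.
    rewrite -{3}(addrK x h); near: h; move: gf.
    by rewrite (near_shift 0 x) /= subr0.
  move/le_trans; apply.
  have hs : `|h| <= e%:num / (`|C| + 1).
    by near: h; apply: nbhs0_le.
  rewrite ler_pdivlMr// in hs.
  rewrite expr2 mulrA ler_wpM2r//.
  apply: le_trans hs; rewrite mulrC ler_wpM2l//.
  by rewrite (le_trans (ler_norm C))// lerDl.
have dc : continuous ('d f x) := diff_continuous df.
have dE := diff_unique dc gE.
by apply: DiffDef => //; apply/diff_locallyP; rewrite dE.
Unshelve. all: by end_near. Qed.

End Differentiability.

Section Nearest.
Context {R : realType} {E : euclideanType R}.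
Implicit Types (S : set E) (x y z : E).

Lemma nearest_projP S x : proj_defined S x -> nearest S x (nearest_proj S x).
Proof. by move=> [y [Sxy _]]; exact: (xgetPex 0 (ex_intro _ y Sxy)). Qed.

Lemma nearest_proj_id S x : S x -> nearest_proj S x = x.
Proof.
move=> Sx; have nx : nearest S x x.
  by split=> // z _; rewrite subrr normr0.
have [_ /(_ x Sx)] : nearest S x (nearest_proj S x).
  exact: (xgetPex 0 (ex_intro _ x nx)).
by rewrite subrr normr0 normr_le0 subr_eq0 => /eqP.
Qed.

(** This identity is where the inner product enters; it yields the uniqueness of nearest points in
    linear subspaces. *)
Lemma parallelogram x y :
  `|x + y| ^+ 2 + `|x - y| ^+ 2 = 2 * (`|x| ^+ 2 + `|y| ^+ 2).
Proof.
have dotDl (u v w : E) : dot (u + v) w = dot u w + dot v w.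
  by have := dot_linear 1 u v w; rewrite scale1r mul1r.
have dotNl (u w : E) : dot (- u) w = - dot u w.
  have := dot_linear (-1) u u w.
  rewrite scaleN1r addNr => d0.
  have := dot_linear (-1) u 0 w; rewrite addr0 scaleN1r => ->.
  have -> : dot (0 : E) w = 0 by rewrite d0 mulN1r addNr.
  by rewrite addr0 mulN1r.
have dotDr (u v w : E) : dot w (u + v) = dot w u + dot w v.
  by rewrite !(dotC w).
have dotNr (u w : E) : dot w (- u) = - dot w u by rewrite !(dotC w).
rewrite -!dot_normE !(dotDl, dotDr, dotNl, dotNr) (dotC y x).
ring.
Qed.

(** The midpoint of two nearest points is again in [T], and by the parallelogram identity it would
    be strictly closer to [x] if they were distinct. *)
Lemma nearest_vspace_unique (T : {vspace E}) x y z :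
  nearest [set h | h \in T] x y -> nearest [set h | h \in T] x z -> y = z.
Proof.
move=> [/= Ty miny] [/= Tz minz]; apply/eqP; rewrite -subr_eq0 -normr_le0.
have yz : `|x - y| = `|x - z|.
  by apply/eqP; rewrite eq_le miny//= minz.
have /miny : (2^-1 *: (y + z)) \in T by rewrite memvZ ?memvD.
have xE : (x - y) + (x - z) = 2 *: (x - 2^-1 *: (y + z)).
  by rewrite scalerBr scalerA divff ?pnatr_eq0// scale1r addrACA -opprD scaler_nat mulr2n.
have := parallelogram (x - y) (x - z).
have -> : x - y - (x - z) = z - y by rewrite opprB [LHS]addrC addrA subrK.
rewrite xE normrZ ger0_norm// -yz [`|z - y|]distrC.
(* With [a], [b], [c] as named below, the identity reads $4c^2 + b^2 = 4a^2$, while $a \le c$ by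
   minimality; hence $b = 0$. *)
move: (normr_ge0 (x - y)) (normr_ge0 (y - z)).
move: `|x - y| `|y - z| `|x - _| => a b c; nra.
Qed.

Lemma nearest_vspace_proj (T : {vspace E}) x y :
  nearest [set h | h \in T] x y -> nearest_proj [set h | h \in T] x = y.
Proof.
move=> ny; apply: (nearest_vspace_unique T x _ _ _ ny).
exact: (xgetPex 0 (ex_intro _ y ny)).
Qed.

Section ProjectionDifferential.
Variables (W : set E) (z : E).
Hypotheses (Wz : W z) (projW : Ck_proj_around 2 W z).

Let P := 'd (nearest_proj W) z.

Lemma nearest_proj_differentiable : differentiable (nearest_proj W) z.
Proof. by have [D [_ Dz [_ [dp _]]]] := projW; exact: dp. Qed.

Lemma velocity_fixed v : velocity W z v -> P v = v.
Proof.
move=> [e [c [e0 [dc _] Wc c0 <-]]].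
have dc0 : differentiable c 0 by apply: dc; exact: ballxx.
have dp : differentiable (nearest_proj W) (c 0).
  by rewrite c0; exact: nearest_proj_differentiable.
(* The chain rule evaluated at [1] expresses [P v] as the derivative at [0] of the projected curve,
   which coincides with [c] near [0]. *)
have := congr1 (fun f : R -> E => f 1) (diff_comp dc0 dp).
rewrite /= c0 -(deriveE _ (differentiable_comp dc0 dp)) derive1E (deriveE _ dc0).
move=> <-; rewrite -(deriveE _ dc0).
apply: near_eq_derive => /=.
near=> t; rewrite /= nearest_proj_id//; apply: Wc.
by near: t; exact: nbhsx_ballx.
Unshelve. all: by end_near. Qed.

Lemma diff_proj_velocity v : velocity W z (P v).
Proof.
have [D [Do Dz [defD [dp cp]]]] := projW.
pose l := fun t : R => z + t *: v.
have dl t : is_diff t l ( *:%R ^~ v) := is_diff_line z v t.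
have l0 : l 0 = z by rewrite /l scale0r addr0.
have lc : {for 0, continuous l} by apply: differentiable_continuous.
have /nbhs_ballP[e /= e0 eD] : \forall t \near (0 : R), D (l t).
  by apply: lc; rewrite l0; exact: open_nbhs_nbhs.
have dc t : ball (0 : R) e t ->
    is_diff t (nearest_proj W \o l) ('d (nearest_proj W) (l t) \o *:%R ^~ v).
  by move=> /eD Dt; apply: is_diff_comp; exact/differentiableP/dp.
exists e, (nearest_proj W \o l); split=> //.
- split=> [t /dc[]//|s t et].
  have dcE (x : R) : ball (0 : R) e x ->
      'd (nearest_proj W \o l) x s = 'd (nearest_proj W) (l x) (s *: v).
    by move=> /dc ?; rewrite diff_val.
  (* The second order of differentiability of the projection makes its differential in the fixed
     direction [s *: v] continuous along the line, as a C^1 curve requires. *)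
  have lim_d : 'd (nearest_proj W) (l x) (s *: v) @[x --> t]
      --> 'd (nearest_proj W) (l t) (s *: v).
    have [cs _] := cp (s *: v).
    apply: (@continuous_comp _ _ _ l (fun y => 'd (nearest_proj W) y (s *: v))).
      exact: differentiable_continuous.
    by apply: differentiable_continuous; apply: cs; exact: eD.
  rewrite -(dcE t et) in lim_d; apply: cvg_trans lim_d.
  have near_t : nbhs t (ball (0 : R) e).
    by apply: open_nbhs_nbhs; split; first exact: ball_open.
  by apply: near_eq_cvg; apply: filterS near_t => x /dcE.
- by move=> t /eD Dt; have [] := nearest_projP _ _ (defD _ Dt).
- by rewrite /= l0 nearest_proj_id.
- have d0 := dc 0 (ballxx _ e0).
  by rewrite derive1E deriveE// diff_val/= l0 scale1r.
Qed.

(** The range of [P] is a linear subspace consisting exactly of the velocities, so the choice in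
    [tangent0] does not fall back on its default value. *)
Lemma tangent0_mem v : (v \in tangent0 W z) <-> velocity W z v.
Proof.
rewrite /tangent0.
apply: (@xgetPex _ 0%VS [set T : {vspace E} | forall v, v \in T <-> velocity W z v]).
exists (limg (linfun P)) => {}v; split.
  by move=> /memv_imgP[u _ ->]; rewrite lfunE; exact: diff_proj_velocity.
by move=> /velocity_fixed <-; rewrite -(lfunE P) memv_img ?memvf.
Qed.

Lemma diff_proj_nearest v : nearest [set h | h \in tangent0 W z] v (P v).
Proof.
split=> [|w /tangent0_mem/velocity_fixed <-] /=.
  exact/tangent0_mem/diff_proj_velocity.
(* Since [z] is its own projection, this is the usual difference quotient. *)
have quot u : t^-1 *: (nearest_proj W (t *: u + z) - z) @[t --> 0^'] --> P u.
  rewrite /P -deriveE; last exact: nearest_proj_differentiable.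
  have : derivable (nearest_proj W) z u.
    exact/diff_derivable/nearest_proj_differentiable.
  by rewrite /derivable /derive /= nearest_proj_id.
have err u : `|v - t^-1 *: (nearest_proj W (t *: u + z) - z)| @[t --> 0^']
    --> `|v - P u|.
  by apply: cvg_norm; apply: cvgB; [exact: cvg_cst|exact: quot].
apply: (ler_cvg_to (err v) (err w)).
have [D [Do Dz [defD _]]] := projW.
have near_dom u : \forall t \near 0^', D (t *: u + z).
  have lc : {for 0, continuous (fun t : R => z + t *: u)}.
    by apply: differentiable_continuous; have [] := is_diff_line z u 0.
  apply: nbhs_dnbhs.
  near=> t; rewrite addrC; near: t.
  by apply: lc; rewrite scale0r addr0; exact: open_nbhs_nbhs.
near=> t.
have t0 : t != 0 by near: t; exact: nbhs_dnbhs_neq.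
have [_ min] : nearest W (t *: v + z) (nearest_proj W (t *: v + z)).
  by apply/nearest_projP/defD; near: t; exact: near_dom.
(* The projection of [t *: w + z] serves only as a competitor in [W] for the distance to
   [t *: v + z]. *)
have [/min le_t _] : nearest W (t *: w + z) (nearest_proj W (t *: w + z)).
  by apply/nearest_projP/defD; near: t; exact: near_dom.
(* Both errors are distances to the same point [t *: v + z], scaled by the same factor. *)
have errE y : `|v - t^-1 *: (y - z)| = `|t|^-1 * `|t *: v + z - y|.
  rewrite -normfV -normrZ; congr `|_|.
  by rewrite -addrA [RHS]scalerDr scalerA mulVf// scale1r -[z - y]opprB scalerN.
by rewrite !errE ler_wpM2l// invr_ge0.
Unshelve. all: by end_near. Qed.

Lemma diff_projE : P = nearest_proj [set h | h \in tangent0 W z] :> (E -> E).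
Proof.
by apply/funext => v; rewrite (nearest_vspace_proj _ _ _ (diff_proj_nearest v)).
Qed.

End ProjectionDifferential.
End Nearest.

Theorem theorem4p2 (R : realType) (E : euclideanType R)
    (V : set E) (F : set E) (F0 : {vspace E}) (zeta : E)
    (V_manifold : submanifold 3 V) (V_neq : V <> setT)
    (F_affine : is_affine F F0) (F_proper : F <> setT)
    (F_zeta : F zeta) (V_zeta : V zeta)
    (projV_around : Ck_proj_around 2 V zeta)
    (V_F_transversal : transversal_at F0 V zeta)
    (U : set E) (U_open : open U) (U_zeta : U zeta)
    (projV_U : Ck_proj_on 2 V U)
    (phi_U : forall x, U x -> F `&` tangent V (nearest_proj V x) !=set0)
    (W : set E) (W_def : W = F `&` V `&` U)
    (W_manifold : submanifold 3 W)
    (projW_around : Ck_proj_around 2 W zeta)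
    (nu gamma gamma' : R)
    (nu_gt0 : 0 < nu) (gamma_gt0 : 0 < gamma) (gamma'_gt0 : 0 < gamma')
    (Phi : E -> E)
    (iter_defined : forall x0, ball zeta nu x0 ->
       forall i, phi_defined F V (iter i (phi F V) x0))
    (iter_cvg : forall x0, ball zeta nu x0 ->
       (iter i (phi F V) x0 @[i --> \oo] --> Phi x0) /\ W (Phi x0))
    (iter_quadratic : forall x0, ball zeta nu x0 -> forall i,
       `|iter i.+1 (phi F V) x0 - Phi x0|
         <= gamma * `|iter i (phi F V) x0 - Phi x0| ^+ 2)
    (projW_quadratic : forall x0, ball zeta nu x0 ->
       proj_defined W x0 /\
       `|nearest_proj W x0 - Phi x0| <= gamma' * `|nearest_proj W x0 - x0| ^+ 2) :
  differentiable Phi zeta /\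
  ('d Phi zeta : E -> E) = nearest_proj [set h | h \in tangent0 W zeta].
Proof.
have Wz : W zeta by rewrite W_def.
have dp := nearest_proj_differentiable _ _ projW_around.
have pz : nearest_proj W zeta = zeta := nearest_proj_id _ _ Wz.
(* At [zeta] the right-hand side of the quadratic estimate vanishes. *)
have Phiz : Phi zeta = zeta.
  have [_] := projW_quadratic _ (ballxx zeta nu_gt0).
  rewrite pz subrr normr0 expr0n mulr0 normr_le0 subr_eq0.
  by move=> /eqP.
have PhiE : is_diff zeta Phi ('d (nearest_proj W) zeta).
  apply: (is_diff_near_quadratic _ _ _ gamma') => //; first by rewrite pz.
  near=> x.
  have /projW_quadratic[/nearest_projP[_ min] quad] : ball zeta nu x.
    by near: x; exact: nbhsx_ballx.
  (* What remains is that the projection of [x] is at least as close to [x] as the point [zeta] of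
     [W]. *)
  rewrite distrC (le_trans quad)// ler_pM2l// lerXn2r ?nnegrE//.
  by rewrite distrC min.
split; first exact: ex_diff.
by rewrite diff_val; exact: diff_projE.
Unshelve. all: by end_near. Qed.
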